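(* Fix a positive integer $n$. For a prime $p$, identify $\mathbb{F}_p=\{\bar 0,\bar 1,\dots,\overline{p-1}\}$ and define $$s_p:\mathrm{SL}_n(\mathbb{F}_p)\to[0,1]^{n^2},\qquad A=(\overline{a_{ij}})\mapsto\Big(\tfrac{a_{ij}}{p}\Big)_{1\le i,j\le n},$$ where $a_{ij}\in\{0,1,\dots,p-1\}$. Let $R\subset[0,1]^{n^2}$ be a measurable set with the following property: for every $\epsilon>0$ there exist two finite collections of non-overlapping rectangles $R_1,\dots,R_k$ and $R^1,\dots,R^l$ such that $\bigcup_{i=1}^k R_i\subset R\subset\bigcup_{j=1}^l R^j$, $\mathrm{area}(R\setminus\bigcup_{i=1}^k R_i)<\epsilon$ and $\mathrm{area}(\bigcup_{j=1}^l R^j\setminus R)<\epsilon$. Then $$\lim_{p\to\infty}\frac{\#(\mathrm{Image}(s_p)\cap R)}{\#\mathrm{SL}_n(\mathbb{F}_p)}=\mathrm{area}(R),$$ where the limit is over primes $p$.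
   Context: A rectangle in $[0,1]^{d}$ means a box, i.e. a product $I_1\times\cdots\times I_d$ of subintervals of $[0,1]$. ''area'' denotes $d$-dimensional Lebesgue measure. $\mathrm{SL}_n(\mathbb{F}_p)$ is the group of $n\times n$ matrices over $\mathbb{F}_p$ of determinant $1$.
   Formalization: The formal theorem assumes n ≥ 2; for n = 1 the claim is false, since SL_1(F_p) = {1} has image {1/p}, and R = [0,1/2] gives ratio 1 for every prime p while area(R) = 1/2. *)

(* Defs.v *)
From HB Require Import structures.
From mathcomp Require Import all_boot all_order all_algebra finmap.
From mathcomp Require Import all_classical all_reals all_analysis.

Set Implicit Arguments.
Unset Strict Implicit.
Unset Printing Implicit Defensive.

Import Order.TTheory GRing.Theory Num.Theory.
Import numFieldNormedType.Exports.

Local Open Scope classical_set_scope.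
Local Open Scope ring_scope.

(* The space of dimension n ^ 2, with coordinates indexed by 1 <= i, j <= n, is
   'M[R]_n with its product topology. *)

Definition unit_cube (R : realType) (n : nat) : set 'M[R]_n :=
  [set x | forall i j, 0 <= x i j <= 1].
Arguments unit_cube R n : clear implicits.

(* The factors may be open, closed, half-open or degenerate intervals. *)
Definition rectangle (R : realType) (n : nat) (B : set 'M[R]_n) : Prop :=
  exists I : 'I_n -> 'I_n -> interval R,
    (forall i j, [set` I i j] `<=` `[0, 1]) /\
    B = [set x | forall i j, x i j \in I i j].

(* Rectangles sharing only boundary points do not overlap. *)
Definition non_overlapping (R : realType) (n k : nat)
    (B : 'I_k -> set 'M[R]_n) : Prop :=
  trivIset [set: 'I_k] (fun a => interior (B a)).

Definition closed_box (R : realType) (n : nat) (a b : 'M[R]_n) : set 'M[R]_n :=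
  [set x | forall i j, a i j <= x i j <= b i j].

Definition box_volume (R : realType) (n : nat) (a b : 'M[R]_n) : R :=
  \prod_(i < n) \prod_(j < n) (b i j - a i j).

(* The Lebesgue outer measure in dimension n ^ 2: the infimum of the total
   volume of the countable covers by closed boxes. On the sets satisfying
   lebesgue_measurable it is the (complete) Lebesgue measure. *)
Definition area (R : realType) (n : nat) (X : set 'M[R]_n) : \bar R :=
  ereal_inf [set v | exists a b : nat -> 'M[R]_n,
    [/\ (forall k i j, a k i j <= b k i j),
        X `<=` \bigcup_k closed_box (a k) (b k) &
        v = (\sum_(0 <= k <oo) (box_volume (a k) (b k))%:E)%E]].

Definition lebesgue_measurable (R : realType) (n : nat) (X : set 'M[R]_n) : Prop :=
  (@area R n).-caratheodory X.

Definition SL (n p : nat) : {set 'M['F_p]_n} := [set A | \det A == 1]%SET.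

(* The coercion of 'F_p to nat selects the representative in {0, ..., p - 1}. *)
Definition s_map (R : realType) (n p : nat) (A : 'M['F_p]_n) : 'M[R]_n :=
  \matrix_(i, j) ((A i j : nat)%:R / p%:R).

Definition image_s (R : realType) (n p : nat) : set 'M[R]_n :=
  @s_map R n p @` [set` SL n p].
Arguments image_s R n p : clear implicits.

(* Main.v *)
Require Import Defs.
From HB Require Import structures.
From mathcomp Require Import all_boot all_order all_algebra finmap.
From mathcomp Require Import all_classical all_reals all_analysis.
From mathcomp Require Import zify ring lra.

(** Write a matrix of determinant 1 as a first row [x] on top of the other rows
    [r]; the condition is [x *m v = 1], where [v] is the vector of cofactors of
    [r]. For a fixed set [P] of rows, the number of [x] in [P] on the affine
    hyperplane [x *m v = 1] has mean about [#|P| / q] and small variance when [v]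
    is uniform, because two distinct points of [P] lie on at most [q ^ (n - 2)]
    common hyperplanes. As [v] is almost uniform when [r] is, Cauchy-Schwarz gives
    #(SL /\ (P x W)) = #|P| #|W| / q + O(q ^ (n ^ 2 - 3 / 2)) for all [P] and [W],
    without exponential sums. Hence SL equidistributes in boxes.
    To pass from boxes to [X], one needs that the total volume of disjoint open
    boxes is at most the outer measure of their union; it is obtained from
    compactness and from the finite additivity of the frequencies themselves. *)

Set Implicit Arguments.
Unset Strict Implicit.
Unset Printing Implicit Defensive.

Import Order.TTheory GRing.Theory Num.Theory.
Import numFieldNormedType.Exports.

Local Open Scope ring_scope.

(** * Counting matrices of determinant 1 over a finite field *)

(** Translation by a preimage of [w2 - w1] injects the fiber over [w1] into the fiber over [w2], so
    all fibers have the same size. *)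
Lemma card_fiber_additive (V W : finZmodType) (f : V -> W) (w : W) :
  {morph f : x y / x + y} -> (forall w, exists v, f v = w) ->
  (#|[set v | f v == w]| * #|W| = #|V|)%N.
Proof.
move=> fD fsurj.
have f0 : f 0 = 0 by apply: (addrI (f 0)); rewrite -fD !addr0.
have fB x y : f (x - y) = f x - f y.
  by apply/eqP; rewrite eq_sym subr_eq -fD subrK.
have le_fib w1 w2 : (#|[set v | f v == w1]| <= #|[set v | f v == w2]|)%N.
  have [u fu] := fsurj (w2 - w1).
  rewrite -(card_imset _ (@addrI _ u)); apply: subset_leq_card.
  apply/fintype.subsetP => _ /imsetP[v + ->]; rewrite !inE fD fu => /eqP ->.
  by rewrite subrK.
rewrite -[RHS]sum1_card (partition_big f predT) //= -[#|W|]sum1_card big_distrr.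
apply: eq_bigr => w' _; rewrite /= muln1 -sum1dep_card.
by rewrite !sum1dep_card; apply/eqP; rewrite eqn_leq !le_fib.
Qed.

(** * Cofactors along the first row *)

Section FirstRowCofactors.
Variables (K : fieldType) (m : nat).
Implicit Types (x : 'rV[K]_(1 + m)) (r : 'M[K]_(m, 1 + m)).

(** Cofactors along the first row do not depend on that row; the zero row is a placeholder. *)
Definition first_cofactors r : 'cV[K]_(1 + m) :=
  \col_j cofactor (col_mx (0 : 'rV_(1 + m)) r) (lshift m ord0) j.

Lemma row'_col_mx_first x r j :
  row' (lshift m ord0) (col' j (col_mx x r)) = col' j r.
Proof.
apply/matrixP => i k; rewrite !mxE.
have -> : lift (lshift m ord0) i = rshift 1 i by apply: val_inj.
by rewrite (unsplitK (inr i)).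
Qed.

Lemma det_col_mx_first x r :
  \det (col_mx x r) = (x *m first_cofactors r) 0 0.
Proof.
rewrite (expand_det_row _ (lshift m ord0)) mxE.
apply: eq_bigr => j _; rewrite !mxE; case: splitP => // k _.
by rewrite [k]ord1 /cofactor !row'_col_mx_first.
Qed.

(** Entry [i] of the product is the determinant of a matrix whose first row repeats row [i] of
    [r]. *)
Lemma mul_first_cofactors r : r *m first_cofactors r = 0.
Proof.
apply/matrixP => i j; rewrite [j]ord1.
have := det_col_mx_first (row i r) r.
rewrite (@determinant_alternate _ _ _ (lshift m ord0) (rshift 1 i)) => [H|//|k].
  by rewrite -row_mul mxE in H; rewrite -H !mxE.
by rewrite col_mxEu col_mxEd mxE.
Qed.

(** Multiplying the lower rows by [D] is multiplying the whole matrix by a block diagonal matrix of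
    determinant [\det D]. The first row [x] is arbitrary, so this determines the cofactors. *)
Lemma first_cofactors_mul (D : 'M[K]_m) r :
  first_cofactors (D *m r) = \det D *: first_cofactors r.
Proof.
have E x : x *m first_cofactors (D *m r) = x *m (\det D *: first_cofactors r).
  apply/matrixP => i j; rewrite [i]ord1 [j]ord1 -scalemxAr [RHS]mxE.
  rewrite -!det_col_mx_first.
  have -> : col_mx x (D *m r) = block_mx 1%:M 0 0 D *m col_mx x r.
    by rewrite mul_block_col mul1mx !mul0mx addr0 add0r.
  by rewrite det_mulmx det_ublock det1 mul1r.
apply/colP => i.
have := congr1 (fun M : 'M[K]_1 => M 0 0) (E (delta_mx 0 i)).
by rewrite -!rowE !mxE.
Qed.

Lemma first_cofactors_eq0 r : first_cofactors r = 0 -> \det (rsubmx r) = 0.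
Proof.
move/colP/(_ (lshift m ord0)); rewrite !mxE /cofactor row'_col_mx_first mul1r => <-.
by congr (\det _); apply/matrixP => i j; rewrite !mxE; congr (r _ _); apply: val_inj.
Qed.
End FirstRowCofactors.

(** * Fibers of linear maps, of the cofactor map and of the determinant *)

Section Counting.
Variable F : finFieldType.
Local Notation q := #|F|.

Lemma card_dot_eq (n : nat) (v : 'cV[F]_n) (t : F) : v != 0 ->
  (#|[set x : 'rV[F]_n | ((x *m v) 0 0 == t)%R]| * q = q ^ n)%N.
Proof.
move=> /matrix0Pn[i [j]]; rewrite [j]ord1 => vi0.
rewrite (card_fiber_additive t) ?card_mx ?mul1n // => [x y|w].
  by rewrite mulmxDl mxE.
exists ((w / v i 0) *: delta_mx 0 i).
by rewrite -scalemxAl -rowE !mxE divfK.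
Qed.

Lemma card_row_dot_eq (n : nat) (x : 'rV[F]_n) (t : F) : x != 0 ->
  (#|[set v : 'cV[F]_n | ((x *m v) 0 0 == t)%R]| * q = q ^ n)%N.
Proof.
move=> /matrix0Pn[i [j xi0]]; rewrite [i]ord1 in xi0.
rewrite (card_fiber_additive t) ?card_mx ?muln1 // => [u v|w].
  by rewrite mulmxDr mxE.
exists ((w / x 0 j) *: delta_mx j 0).
by rewrite -scalemxAr -colE !mxE divfK.
Qed.

Lemma card_mulmx_col_eq0 (m n : nat) (v : 'cV[F]_n) : v != 0 ->
  (#|[set r : 'M[F]_(m, n) | (r *m v == 0)%R]| * q ^ m = q ^ (m * n))%N.
Proof.
move=> /matrix0Pn[i [j]]; rewrite [j]ord1 => vi0.
have -> : (q ^ m = #|{: 'cV[F]_m}|)%N by rewrite card_mx muln1.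
rewrite (card_fiber_additive 0) ?card_mx // => [x y|w]; first exact: mulmxDl.
exists ((v i 0)^-1 *: (w *m delta_mx 0 i)).
rewrite -scalemxAl -mulmxA -rowE; apply/colP => k.
by rewrite !mxE big_ord1 !mxE mulrC mulfK.
Qed.

(* The rows of [r] are orthogonal to [v], and rescaling the first row of [r] by
   the nonzero scalars turns one fiber into [q - 1] disjoint sets of such [r]. *)
Lemma card_first_cofactors (m : nat) (v : 'cV[F]_(1 + m)) :
  (0 < m)%N -> v != 0 ->
  (q.-1 * #|[set r : 'M[F]_(m, 1 + m) | first_cofactors r == v]| * q ^ m
    <= q ^ (m * (1 + m)))%N.
Proof.
case: m v => // m v _ v0.
rewrite -(card_mulmx_col_eq0 _ v0) leq_mul2r; apply/orP; right.
pose d (t : F) : 'rV[F]_m.+1 := \row_i (if i == 0 then t else 1).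
have detd t : \det (diag_mx (d t)) = t.
  rewrite det_diag (bigD1 0) //= mxE eqxx big1 ?mulr1 // => i /negPf i0.
  by rewrite mxE i0.
pose g (z : F * 'M[F]_(m.+1, 1 + m.+1)) := diag_mx (d z.1) *m z.2.
have -> : q.-1 = #|[set~ (0 : F)]| by rewrite cardsC1.
rewrite -cardsX -(card_in_imset (f := g)) => [|[t r] [t' r']].
  apply: subset_leq_card; apply/fintype.subsetP => _ /imsetP[[t r] + ->].
  rewrite !inE /= => /andP[t0 /eqP rv]; rewrite /g /= -mulmxA -rv.
  by rewrite mul_first_cofactors mulmx0.
rewrite !inE /g /= => /andP[t0 /eqP rv] /andP[t'0 /eqP r'v] E.
(* Comparing cofactors gives [t *: v = t' *: v], hence [t = t'] as [v] is nonzero; the invertible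
   diagonal matrix then cancels. *)
have /eqP := congr1 (@first_cofactors _ _) E.
rewrite !first_cofactors_mul rv r'v !detd -subr_eq0 -scalerBl scaler_eq0.
rewrite (negPf v0) orbF subr_eq0 => /eqP tt'; subst t'; congr pair.
have U : diag_mx (d t) \in unitmx by rewrite unitmxE detd unitfE.
by rewrite -[r](mulKmx U) E mulKmx.
Qed.

Lemma card_col_mx_split (m1 m2 n : nat)
    (P : 'M[F]_(m1, n) -> 'M[F]_(m2, n) -> bool) :
  (#|[set A : 'M[F]_(m1 + m2, n) | P (usubmx A) (dsubmx A)]| =
   \sum_(r : 'M[F]_(m2, n)) #|[set x | P x r]|)%N.
Proof.
rewrite -sum1dep_card (partition_big (@dsubmx _ m1 m2 n) predT) //=.
apply: eq_bigr => r _.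
rewrite -(card_imset _ (can_inj (fun x => col_mxKu x r))).
rewrite -[RHS]sum1_card; apply: eq_bigl => A.
apply/andP/imsetP => [[PA /eqP <-]|[x + ->]].
  by exists (usubmx A); rewrite ?vsubmxK ?inE.
by rewrite !inE col_mxKu col_mxKd.
Qed.

(** The first column of [r] is free, while the remaining square block is a minor that must
    vanish. *)
Lemma card_first_cofactors_eq0_le (m : nat) :
  (#|[set r : 'M[F]_(m, 1 + m) | (first_cofactors r == 0)%R]|
    <= q ^ m * #|[set A : 'M[F]_m | (\det A == 0)%R]|)%N.
Proof.
pose g (r : 'M[F]_(m, 1 + m)) := (lsubmx r, rsubmx r).
have gI : injective g.
  by apply: (can_inj (g := fun z => row_mx z.1 z.2)) => r; apply: hsubmxK.
have -> : (q ^ m = #|[set: 'M[F]_(m, 1)]|)%N by rewrite cardsT card_mx muln1.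
rewrite -cardsX -(card_imset _ gI); apply: subset_leq_card.
apply/fintype.subsetP => _ /imsetP[r + ->]; rewrite !inE => /eqP r0.
by rewrite first_cofactors_eq0 ?eqxx.
Qed.

(** Induction on the size, by cases on the lower rows. If their cofactors are not all 0, the first
    row solves one nontrivial linear equation, which contributes 1 to the constant. Otherwise the
    first row is free, but a minor of size [m] is singular and the induction hypothesis contributes
    [m]. *)
Lemma card_det_eq0 (m : nat) :
  (#|[set A : 'M[F]_m | (\det A == 0)%R]| * q <= m * q ^ (m * m))%N.
Proof.
elim: m => [|m IH].
  rewrite (_ : [set A | _] = finset.set0) ?cards0 //.
  by apply/setP => A; rewrite !inE det_mx00 oner_eq0.
pose phi (x : 'rV[F]_(1 + m)) (r : 'M[F]_(m, 1 + m)) :=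
  ((x *m first_cofactors r) 0 0 == 0)%R.
have -> : [set A : 'M[F]_m.+1 | (\det A == 0)%R] =
    [set A : 'M[F]_(1 + m, 1 + m) | phi (usubmx A) (dsubmx A)].
  by apply/setP => A; rewrite !inE /phi -det_col_mx_first vsubmxK.
rewrite (@card_col_mx_split 1 m (1 + m) phi) {}/phi.
rewrite big_distrl /= (bigID (fun r => first_cofactors r == 0)) /=.
rewrite mulSn addnC leq_add //.
  apply: (@leq_trans (\sum_(r : 'M[F]_(m, 1 + m)) q ^ m.+1)).
    rewrite [leqRHS](bigID (fun r => first_cofactors r != 0)) /=.
    rewrite -[leqLHS]addn0 leq_add // leq_sum // => r r0.
    by rewrite card_dot_eq.
  by rewrite sum_nat_const card_mx -expnD addnC -mulSn.
apply: (@leq_trans (q ^ m * #|[set A : 'M[F]_m | (\det A == 0)%R]| * q ^ m.+1 * q)).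
  apply: (@leq_trans (\sum_(r : 'M[F]_(m, 1 + m) | first_cofactors r == 0)
      q ^ m.+1 * q)).
    apply: leq_sum => r _; rewrite leq_mul2r -[m.+1 in leqRHS]mul1n -card_mx.
    by rewrite max_card orbT.
  rewrite sum_nat_cond_const mulnA !leq_mul2r.
  by have := card_first_cofactors_eq0_le m; rewrite cardsE => ->; rewrite !orbT.
set z := #|_| in IH *.
rewrite (_ : _ * _ = z * q * (q ^ m * q ^ m.+1))%N; last by rewrite -!mulnA; ring.
apply: (leq_trans (leq_mul IH (leqnn _))).
by rewrite -mulnA -!expnD leq_mul2l leq_exp2l ?card_finNzRing_gt1 //; lia.
Qed.

Lemma card_first_cofactors_eq0 (m : nat) :
  (#|[set r : 'M[F]_(m, 1 + m) | (first_cofactors r == 0)%R]| * q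
    <= m * q ^ (m * (1 + m)))%N.
Proof.
apply: (leq_trans (leq_mul (card_first_cofactors_eq0_le m) (leqnn q))).
rewrite -mulnA; apply: (leq_trans (leq_mul (leqnn _) (card_det_eq0 m))).
by rewrite mulnCA -expnD mulnDr muln1.
Qed.
End Counting.

(** * Second moment of the number of points on a random affine hyperplane *)

Section SecondMoment.
Variable F : finFieldType.
Local Notation q := #|F|.

Lemma sum_nat_of_bool (T : finType) (A p : pred T) :
  (\sum_(x in A) p x = #|[set x in A | p x]|)%N.
Proof.
rewrite -sum1dep_card [RHS]big_mkcond [LHS]big_mkcond; apply: eq_bigr => x _.
by case: (x \in A) => //=; case: (p x).
Qed.

(** If some 2 x 2 minor of the rows [x] and [y] is nonzero, the two linear forms are jointly
    surjective. If all minors vanish, the two equations together would force [x = y]. *)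
Lemma card_dot_pair (n : nat) (x y : 'rV[F]_n) : x != y ->
  (#|[set v : 'cV[F]_n | ((x *m v) 0 0 == 1)%R && ((y *m v) 0 0 == 1)%R]| * q ^ 2
    <= q ^ n)%N.
Proof.
move=> xy.
case: (boolP [exists i, exists j, x 0 i * y 0 j - x 0 j * y 0 i != 0]).
  move=> /existsP[i /existsP[j D0]]; set D := _ - _ in D0.
  pose f (v : 'cV[F]_n) : 'cV[F]_(1 + 1) := col_mx (x *m v) (y *m v).
  have -> : (q ^ 2 = #|{: 'cV[F]_(1 + 1)}|)%N by rewrite card_mx.
  rewrite -[(q ^ n)%N](_ : #|{: 'cV[F]_n}| = _); last by rewrite card_mx muln1.
  rewrite -(card_fiber_additive (f := f) (const_mx 1)).
  - rewrite leq_mul2r; apply/orP; right; apply: subset_leq_card.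
    apply/fintype.subsetP => v; rewrite !inE => /andP[/eqP xv /eqP yv].
    by rewrite -col_mx_const; apply/eqP; congr col_mx;
      apply/matrixP => k l; rewrite !ord1 ?xv ?yv mxE.
  - by move=> u v; rewrite /f !mulmxDr add_col_mx.
  move=> w; pose a := usubmx w 0 0; pose b := dsubmx w 0 0.
  (* Cramer's rule in the coordinates [i] and [j], with determinant [D]. *)
  exists (((a * y 0 j - b * x 0 j) / D) *: delta_mx i 0 +
          ((b * x 0 i - a * y 0 i) / D) *: delta_mx j 0).
  rewrite -[RHS]vsubmxK; congr col_mx; apply/matrixP => k l; rewrite !ord1.
    rewrite !mulmxDr -!scalemxAr -!colE -[usubmx w 0 0]/a !mxE.
    by rewrite /D in D0 *; field.
  rewrite !mulmxDr -!scalemxAr -!colE -[dsubmx w 0 0]/b !mxE.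
  by rewrite /D in D0 *; field.
rewrite negb_exists => /forallP par.
rewrite (_ : [set v | _] = finset.set0) ?cards0 //; apply/setP => v; rewrite !inE.
apply/negP => /andP[/eqP xv /eqP yv]; case/negP: xy; apply/eqP/rowP => i.
(* Coordinate [i] of [x] times [y *m v] equals coordinate [i] of [y] times [x *m v], term by term,
   and both products with [v] are 1. *)
rewrite -[LHS]mulr1 -[RHS]mulr1 -[in LHS]yv -xv !mxE !big_distrr /=.
apply: eq_bigr => j _; rewrite !mulrA; congr (_ * _).
have := par i; rewrite negb_exists => /forallP/(_ j); rewrite negbK subr_eq0.
by rewrite [y 0 i * _]mulrC => /eqP.
Qed.

Variables (n : nat) (P : {set 'rV[F]_n}).
Let N (v : 'cV[F]_n) : nat := #|[set x in P | ((x *m v) 0 0 == 1)%R]|.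

Let NE v : N v = (\sum_(x in P) ((x *m v) 0 0 == 1)%R)%N.
Proof. by rewrite sum_nat_of_bool. Qed.

(** A nonzero [x] lies on the hyperplanes of exactly one [v] in [q]; the zero row lies on none,
    which costs the extra [q ^ n]. *)
Lemma sum_card_hyperplane_ge : (#|P| * q ^ n <= (\sum_v N v) * q + q ^ n)%N.
Proof.
rewrite (eq_bigr _ (fun v _ => NE v)) exchange_big /= big_distrl /=.
rewrite -sum1_card big_distrl /= (bigID (fun x => x != 0)) /=.
rewrite [X in (_ <= X + _)%N](bigID (fun x => x != 0)) /= -addnA leq_add //.
  apply: leq_sum => x /andP[_ x0].
  rewrite mul1n -(card_row_dot_eq 1 x0) leq_mul2r; apply/orP; right.
  rewrite -sum1dep_card [leqLHS]big_mkcond; apply: leq_sum => v _.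
  by case: (_ == _).
apply: leq_trans (leq_addl _ _).
rewrite (eq_bigr (fun=> q ^ n)%N) => [|x _]; last by rewrite mul1n.
rewrite sum_nat_const -[leqRHS]mul1n leq_mul2r; apply/orP; right.
apply: (@leq_trans #|[set (0 : 'rV[F]_n)]|); last by rewrite cards1.
apply: subset_leq_card; apply/fintype.subsetP => x.
by rewrite inE => /andP[_]; rewrite negbK.
Qed.

(** The square of [N v] counts pairs of points. Diagonal pairs give the first term on the right,
    distinct pairs the second by [card_dot_pair]. *)
Lemma sum_card_hyperplane_sqr_le :
  ((\sum_v N v * N v) * q ^ 2 <= #|P| * q ^ n * q + #|P| ^ 2 * q ^ n)%N.
Proof.
have -> : (\sum_v N v * N v = \sum_(x in P) \sum_(y in P)
    #|[set v : 'cV[F]_n | ((x *m v) 0 0 == 1)%R && ((y *m v) 0 0 == 1)%R]|)%N.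
  rewrite (eq_bigr (fun v => \sum_(x in P) \sum_(y in P)
     ((x *m v) 0 0 == 1)%R * ((y *m v) 0 0 == 1)%R)%N) => [|v _]; last first.
    by rewrite NE big_distrlr.
  rewrite exchange_big; apply: eq_bigr => x _.
  rewrite exchange_big; apply: eq_bigr => y _.
  rewrite -sum1dep_card [RHS]big_mkcond; apply: eq_bigr => v _.
  by case: eqP; case: eqP.
have -> : (#|P| * q ^ n * q = \sum_(x in P) \sum_(y in P) (x == y) * (q ^ n * q))%N.
  rewrite -mulnA -sum_nat_const; apply: eq_bigr => x xP.
  rewrite (bigD1 x) //= eqxx mul1n big1 ?addn0 // => y /andP[_ /negPf].
  by rewrite eq_sym => ->.
have -> : (#|P| ^ 2 * q ^ n = \sum_(x in P) \sum_(y in P) q ^ n)%N.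
  by rewrite !sum_nat_const mulnA.
rewrite big_distrl -big_split; apply: leq_sum => x _.
rewrite [leqLHS]big_distrl -big_split; apply: leq_sum => y _ /=.
case: eqVneq => [<-|xy]; last exact: card_dot_pair.
rewrite mul1n.
apply: (@leq_trans (#|[set v : 'cV[F]_n | ((x *m v) 0 0 == 1)%R]| * q * q)).
  rewrite -mulnA leq_mul2r; apply/orP; right; apply: subset_leq_card.
  by apply/fintype.subsetP => v; rewrite !inE => /andP[].
have [->|x0] := eqVneq x 0; last by rewrite card_row_dot_eq ?leq_addr.
rewrite (_ : [set v | _] = finset.set0) ?cards0 //; apply/setP => v.
by rewrite !inE mul0mx mxE eq_sym oner_eq0.
Qed.

(** When the square is expanded, the terms quadratic in [#|P|] cancel. In the constant 3, the
    diagonal pairs account for 1 and the slack of the first moment for 2. *)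
Lemma hyperplane_second_moment (R : realFieldType) :
  \sum_v ((N v)%:R - #|P|%:R / q%:R) ^+ 2 <=
    3 * #|P|%:R * q%:R ^+ n / q%:R :> R.
Proof.
have q0 : (0 : R) < q%:R by rewrite ltr0n; apply/card_gt0P; exists 0.
have q1 : (1 : R) <= q%:R by rewrite ler1n; apply/card_gt0P; exists 0.
have S1 := sum_card_hyperplane_ge; have S2 := sum_card_hyperplane_sqr_le.
rewrite -(ler_nat R) !(natrD, natrM, natrX) in S1.
rewrite -(ler_nat R) !(natrD, natrM, natrX) in S2.
have Vc : #|{: 'cV[F]_n}|%:R = q%:R ^+ n :> R by rewrite card_mx muln1 natrX.
have -> : \sum_v ((N v)%:R - #|P|%:R / q%:R) ^+ 2 =
   (\sum_v N v * N v)%N%:R - 2 * (#|P|%:R / q%:R) * (\sum_v N v)%N%:R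
     + q%:R ^+ n * (#|P|%:R / q%:R) ^+ 2 :> R.
  have -> : q%:R ^+ n * (#|P|%:R / q%:R) ^+ 2 =
      \sum_(v : 'cV[F]_n) (#|P|%:R / q%:R) ^+ 2 :> R.
    by rewrite sumr_const -Vc -[RHS]mulr_natl; congr (_%:R * _); apply: eq_card.
  rewrite !natr_sum mulr_sumr -sumrB -big_split.
  by apply: eq_bigr => v _ /=; rewrite natrM; ring.
set S := (\sum_v N v * N v)%N%:R in S2 *; set S' := (\sum_v N v)%N%:R in S1 *.
set V := q%:R ^+ n in S1 S2 *; set k := #|P|%:R in S1 S2 *.
set Q := q%:R in S1 S2 q0 q1 *.
have k0 : 0 <= k by apply: ler0n.
have V0 : 0 <= V by apply: exprn_ge0; apply: ltW.
rewrite -(ler_pM2r (x := Q ^+ 2)) ?exprn_gt0 //.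
have -> : 3 * k * V / Q * Q ^+ 2 = 3 * (k * V) * Q by field; rewrite gt_eqF.
have -> : (S - 2 * (k / Q) * S' + V * (k / Q) ^+ 2) * Q ^+ 2 =
   S * Q ^+ 2 - 2 * k * (S' * Q) + V * k ^+ 2 by field; rewrite gt_eqF.
have kV : k * V <= k * V * Q by rewrite ler_peMr ?mulr_ge0.
have := ler_wpM2l k0 S1; rewrite mulrDr.
nra.
Qed.
End SecondMoment.

(** Cauchy-Schwarz against the constant 1: the sum of the squared deviations from the mean is
    nonnegative. *)
Lemma sqr_sum_le (R : realFieldType) (I : finType) (A : {pred I}) (f : I -> R) :
  (\sum_(i in A) f i) ^+ 2 <= #|A|%:R * \sum_(i in A) f i ^+ 2.
Proof.
have [A0|A0] := posnP #|A|.
  by rewrite big1 ?expr0n ?A0 ?mul0r // => i; rewrite (card0_eq A0).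
have k0 : 0 < #|A|%:R :> R by rewrite ltr0n.
set k := #|A|%:R in k0 *; set s := \sum_(i in A) f i.
have : 0 <= \sum_(i in A) (f i - s / k) ^+ 2.
  by apply: sumr_ge0 => i _; apply: sqr_ge0.
have -> : \sum_(i in A) (f i - s / k) ^+ 2 =
   \sum_(i in A) f i ^+ 2 - s ^+ 2 / k.
  have -> : s ^+ 2 / k = 2 * (s / k) * s - k * (s / k) ^+ 2.
    by field; rewrite gt_eqF.
  rewrite opprB addrCA [k * _]mulr_natl -sumr_const mulr_sumr -sumrB -big_split.
  by apply: eq_bigr => i _ /=; ring.
by rewrite subr_ge0 ler_pdivrMr // mulrC.
Qed.

(* The first row of [A] ranges over the affine hyperplane [x *m v = 1], where
   [v] is the vector of cofactors of the other rows. Each nonzero [v] arises from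
   at most twice the average number of matrices of rows, so the second moment over
   all [v] controls the average over the rows. *)
Lemma card_det1_split (F : finFieldType) (R : realFieldType) (m : nat)
    (P : {set 'rV[F]_(1 + m)}) (W : {set 'M[F]_(m, 1 + m)}) : (0 < m)%N ->
  (#|[set A : 'M[F]_(1 + m) |
      [&& \det A == 1, usubmx A \in P & dsubmx A \in W]]|%:R
    - #|P|%:R * #|W|%:R / #|F|%:R) ^+ 2
  <= (m + 6)%:R * (#|F|%:R ^+ ((1 + m) * (1 + m)) / #|F|%:R) ^+ 2 / #|F|%:R :> R.
Proof.
move=> m0; set q := #|F|.
have q1 : (1 < q)%N by apply: card_finNzRing_gt1.
pose N (v : 'cV[F]_(1 + m)) := #|[set x in P | (x *m v) 0 0 == 1]|.
have -> : #|[set A : 'M[F]_(1 + m) |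
      [&& \det A == 1, usubmx A \in P & dsubmx A \in W]]| =
    (\sum_(r in W) N (first_cofactors r))%N.
  pose phi x r := [&& (x *m first_cofactors r) 0 0 == 1, x \in P & r \in W].
  have -> : [set A : 'M[F]_(1 + m) |
       [&& \det A == 1, usubmx A \in P & dsubmx A \in W]] =
     [set A : 'M[F]_(1 + m, 1 + m) | phi (usubmx A) (dsubmx A)].
    by apply/setP => A; rewrite !inE /phi -det_col_mx_first vsubmxK.
  rewrite (@card_col_mx_split F 1 m (1 + m) phi) [RHS]big_mkcond.
  apply: eq_bigr => r _; case: ifP => rW.
    by apply: eq_card => x; rewrite !inE /phi rW andbT andbC.
  apply/eqP; rewrite cards_eq0; apply/eqP/setP => x.
  by rewrite !inE /phi rW !andbF.
set Q := q%:R; set c := #|P|%:R / Q.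
have Q0 : 0 < Q :> R by rewrite ltr0n ltnW.
have Q1 : 1 <= Q :> R by rewrite ler1n ltnW.
pose V := Q ^+ (1 + m); pose M := Q ^+ (m * (1 + m)).
have V0 : 0 < V by rewrite exprn_gt0.
have M0 : 0 < M by rewrite exprn_gt0.
have cV : c <= V / Q.
  rewrite ler_pM2r ?invr_gt0 // /V -natrX ler_nat.
  by rewrite (leq_trans (max_card _)) // card_mx mul1n.
have c0 : 0 <= c by rewrite divr_ge0 ?ler0n ?ltW.
have -> : (\sum_(r in W) N (first_cofactors r))%:R - #|P|%:R * #|W|%:R / Q =
   \sum_(r in W) ((N (first_cofactors r))%:R - c).
  by rewrite natr_sum sumrB sumr_const -[c *+ _]mulr_natr mulrAC.
apply: (le_trans (sqr_sum_le _ _)).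
have Wle : #|W|%:R <= M.
  by rewrite /M -natrX ler_nat (leq_trans (max_card _)) // card_mx.
pose g v : R := ((N v)%:R - c) ^+ 2.
have g0 v : 0 <= g v by apply: sqr_ge0.
have sum_g : \sum_(r in W) g (first_cofactors r) <= (m + 6)%:R * M * V ^+ 2 / Q ^+ 3.
  apply: (@le_trans _ _ (\sum_r g (first_cofactors r))).
    rewrite [leRHS](bigID (mem W)) /= lerDl; apply: sumr_ge0 => *; exact: g0.
  rewrite (partition_big (@first_cofactors _ _) predT) //=.
  rewrite (eq_bigr (fun v =>
    #|[set r | first_cofactors r == v]|%:R * g v)); last first.
    move=> v _; rewrite (eq_bigr (fun=> g v)) => [|r /eqP -> //].
    by rewrite sumr_const cardsE [RHS]mulr_natl.
  rewrite (bigD1 0) //=.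
  (* No [x] satisfies [x *m 0 = 1], so at [v = 0] the deviation is all of [c]; such [r] form a
     proportion of at most [m / Q]. *)
  have z0 : #|[set r | first_cofactors r == 0 :> 'cV[F]_(1 + m)]|%:R * g 0 <=
      m%:R * M / Q * (V / Q) ^+ 2.
    apply: ler_pM => //.
      rewrite ler_pdivlMr // /M -!natrX -!natrM ler_nat.
      exact: card_first_cofactors_eq0.
    rewrite /g /N (_ : [set x in P | _] = finset.set0) ?cards0 => [|].
      by rewrite sub0r sqrrN ler_pXn2r // nnegrE ?divr_ge0 // ltW.
    by apply/setP => x; rewrite !inE mulmx0 mxE eq_sym oner_eq0 andbF.
  have z1 : \sum_(v | v != 0) #|[set r | first_cofactors r == v]|%:R * g v <=
      (2 * M / V) * (3 * V ^+ 2 / Q).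
    apply: (@le_trans _ _ (\sum_(v | v != 0) 2 * M / V * g v)).
      apply: ler_sum => v v0; apply: ler_wpM2r => //.
      rewrite ler_pdivlMr // /M /V -!natrX -[2]/(2%:R) -!natrM ler_nat.
      have := card_first_cofactors m0 v0; rewrite -/q.
      set z := #|_| => Hz; rewrite expnS mulnA -(leq_pmul2l (m := 1)) //.
      have : (q <= 2 * q.-1)%N by lia.
      by nia.
    rewrite -mulr_sumr; apply: ler_wpM2l.
      by rewrite ltW // divr_gt0 ?mulr_gt0.
    apply: (@le_trans _ _ (\sum_v g v)).
      by rewrite [leRHS](bigD1 0) //= lerDr.
    apply: (le_trans (@hyperplane_second_moment F _ P R)).
    rewrite -/q -/Q -/V ler_pM2r ?invr_gt0 // expr2 mulrA ler_pM2r // ler_pM2l //.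
    by rewrite /V -natrX ler_nat (leq_trans (max_card _)) // card_mx mul1n.
  apply: (le_trans (lerD z0 z1)).
  (* As [1 + m] is at least 2, the nonzero [v] also contribute a multiple of [M * V ^+ 2 / Q ^+ 3];
     its coefficient 6 is 2 from the fibers times 3 from the second moment. *)
  have QV : Q ^+ 2 <= V by rewrite /V ler_weXn2l.
  have -> : 2 * M / V * (3 * V ^+ 2 / Q) = 6 * M * V * Q ^+ 2 / Q ^+ 3.
    by field; rewrite !gt_eqF.
  have -> : m%:R * M / Q * (V / Q) ^+ 2 = m%:R * M * V ^+ 2 / Q ^+ 3.
    by field; rewrite !gt_eqF.
  rewrite -mulrDl ler_pM2r ?invr_gt0 ?exprn_gt0 //.
  have -> : (m + 6)%:R * M * V ^+ 2 = m%:R * M * V ^+ 2 + 6 * M * V * V.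
    by rewrite natrD; ring.
  by rewrite lerD2l ler_pM2l // !mulr_gt0.
apply: (@le_trans _ _ (M * ((m + 6)%:R * M * V ^+ 2 / Q ^+ 3))).
  by apply: ler_pM => //; apply: sumr_ge0 => r _; exact: g0.
rewrite (_ : (1 + m) * (1 + m) = m * (1 + m) + (1 + m))%N; last by ring.
rewrite exprD -/M -/V; set k := _%:R.
by rewrite le_eqVlt; apply/orP; left; apply/eqP; field; rewrite gt_eqF.
Qed.

Local Open Scope classical_set_scope.

(** * Frequencies of SL in boxes *)

Lemma card_box_mx (T : finType) (m n : nat) (S : 'I_m -> 'I_n -> {set T}) :
  (#|[set A : 'M[T]_(m, n) | [forall i, forall j, A i j \in S i j]]%SET| =
    \prod_(i < m) \prod_(j < n) #|S i j|)%N.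
Proof.
rewrite pair_big /=.
transitivity (\prod_(p : 'I_m * 'I_n) \sum_(t : T) (t \in S p.1 p.2))%N; last first.
  apply: eq_bigr => p _; rewrite -sum1_card [RHS]big_mkcond.
  by apply: eq_bigr => t _; case: (t \in _).
(* Distributivity turns the product of sums of indicators into a sum over all matrices. *)
rewrite bigA_distr_bigA /= -sum1dep_card big_mkcond /=.
rewrite (reindex (fun f : {ffun 'I_m * 'I_n -> T} => Matrix f)); last first.
  by exists (@mx_val _ _ _) => [f|[f]].
apply: eq_bigr => f _; case: ifP => [/forallP fS|/negbT].
  rewrite big1 // => -[i j] _; have /forallP/(_ j) := fS i.
  by rewrite /fun_of_matrix /= => ->.
rewrite negb_forall => /existsP[i]; rewrite negb_forall => /existsP[j ij].
by rewrite (bigD1 (i, j)) //= (negPf ij).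
Qed.

(** * Multiples of 1/p in an interval *)

Section CountPoints.
Variable R : realType.

Definition count_frac (p : nat) (I : set R) : nat :=
  (\sum_(0 <= k < p) `[< I (k%:R / p%:R) >])%N.

Lemma count_lt_ge (p : nat) (y : R) : y <= p%:R ->
  y <= (\sum_(0 <= k < p) ((k%:R : R) < y)%R)%N%:R.
Proof.
(* Truncating [y] at [p] gives a form without hypothesis on [y], suited to induction on [p]. *)
suff : Num.min y p%:R <= (\sum_(0 <= k < p) ((k%:R : R) < y)%R)%N%:R.
  by move=> /[swap]; case: leP => // /[swap].
elim: p => [|p IH]; first by rewrite big_geq // ge_min lexx orbT.
rewrite big_nat_recr //= natrD; move: IH.
case: (ltP p%:R y) => py IH.
  by rewrite ge_min -natr1 lerD2r IH orbT.
by rewrite addr0 ge_min IH.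
Qed.

Lemma count_le_le (p : nat) (y : R) : 0 <= y + 1 ->
  (\sum_(0 <= k < p) ((k%:R : R) <= y)%R)%N%:R <= y + 1.
Proof.
move=> y0; elim: p => [|p IH]; first by rewrite big_geq.
rewrite big_nat_recr //=; case: (leP p%:R y) => py /=; last by rewrite addn0.
rewrite natrD lerD2r; apply: le_trans py.
rewrite ler_nat -[leqRHS]subn0 -[leqRHS]muln1 -sum_nat_const_nat.
by apply: leq_sum => k _; case: (_ <= _).
Qed.

(** Subtract the integers below [a p], at least [a p] many, from those up to [b p], at most
    [b p + 1] many. These two bounds require [a <= 1] and [b p + 1] nonnegative; for [1 < a] or
    [b < 0] the count is 0. *)
Lemma count_frac_closed_le (p : nat) (a b : R) : (0 < p)%N -> a <= b ->
  (count_frac p [set x | a <= x <= b])%:R / p%:R <= b - a + p%:R^-1.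
Proof.
move=> p0 ab; have P0 : 0 < p%:R :> R by rewrite ltr0n.
rewrite ler_pdivrMr // mulrDl mulVf ?gt_eqF //.
have rhs0 : 0 <= (b - a) * p%:R + 1 by rewrite addr_ge0 ?mulr_ge0 ?subr_ge0.
have [pa|pa] := leP (a * p%:R) p%:R; last first.
  rewrite /count_frac big1_seq => [|k]; first exact: rhs0.
  rewrite mem_index_iota /= => kp; case: asboolP => //= /andP[+ _].
  rewrite ler_pdivlMr // => ak; have := lt_le_trans pa ak.
  by rewrite ltr_nat ltnNge ltnW.
have [b0|b0] := ltP b 0.
  rewrite /count_frac big1_seq => [|k _]; first exact: rhs0.
  case: asboolP => //= /andP[_ kb]; have := le_lt_trans kb b0.
  by rewrite ltNge divr_ge0.
have b1 : 0 <= b * p%:R + 1 by rewrite addr_ge0 ?mulr_ge0.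
have := count_lt_ge pa; have := count_le_le p b1.
suff : (count_frac p [set x | (a <= x <= b)%R] +
  \sum_(0 <= k < p) ((k%:R : R) < a * p%:R)%R <=
  \sum_(0 <= k < p) ((k%:R : R) <= b * p%:R)%R)%N.
  by rewrite -(ler_nat R) natrD; lra.
rewrite -big_split; apply: leq_sum => k _ /=.
case: asboolP => /= [/andP[]|_].
  rewrite ler_pdivlMr // ler_pdivrMr // => ak ->.
  by rewrite ltNge ak.
case: (ltP k%:R (a * p%:R)) => //= ka.
by rewrite (le_trans (ltW ka)) // ler_wpM2r // ltW.
Qed.

Lemma count_frac_open_ge (p : nat) (a b : R) : (0 < p)%N -> 0 <= a -> b <= 1 ->
  b - a - p%:R^-1 <= (count_frac p [set x | a < x < b])%:R / p%:R.
Proof.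
move=> p0 a0 b1; have P0 : 0 < p%:R :> R by rewrite ltr0n.
rewrite ler_pdivlMr // mulrBl mulVf ?gt_eqF //.
have pb : b * p%:R <= p%:R by rewrite ler_piMl // ltW.
have a1 : 0 <= a * p%:R + 1 by rewrite addr_ge0 ?mulr_ge0.
have := count_lt_ge pb; have := count_le_le p a1.
suff : (\sum_(0 <= k < p) ((k%:R : R) < b * p%:R)%R <=
  count_frac p [set x | (a < x < b)%R] +
  \sum_(0 <= k < p) ((k%:R : R) <= a * p%:R)%R)%N.
  by rewrite -(ler_nat R) natrD; lra.
rewrite -big_split; apply: leq_sum => k _ /=.
case: asboolP => /= [_|]; first by apply: leq_trans (leq_addr _ _); case: (_ < _).
move/negP; rewrite negb_and -!leNgt ler_pdivrMr // ler_pdivlMr //.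
by case: (ltP k%:R (b * p%:R)) => //= kb; rewrite orbF => ->.
Qed.

Lemma count_frac_mono (p : nat) (I J : set R) : I `<=` J ->
  (count_frac p I <= count_frac p J)%N.
Proof.
move=> IJ; apply: leq_sum => k _; case: asboolP => // /IJ Jk.
by rewrite (introT (asboolP _) Jk).
Qed.

Lemma count_frac_le (p : nat) (I : set R) : (count_frac p I <= p)%N.
Proof.
rewrite -[leqRHS]subn0 -[leqRHS]muln1 -sum_nat_const_nat.
by apply: leq_sum => k _; case: asboolP.
Qed.

Lemma card_Fp_frac (p : nat) (I : set R) : prime p ->
  #|[set t : 'F_p | `[< I ((t : nat)%:R / p%:R) >]]%SET| = count_frac p I.
Proof.
move=> pp; rewrite /count_frac -[X in index_iota 0 X](Fp_cast pp) big_mkord.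
rewrite -sum1dep_card big_mkcond; apply: eq_bigr => t _.
by case: asboolP.
Qed.
End CountPoints.

Section FrequencyOfSL.
Variable R : realType.

Definition box (n : nat) (I : 'I_n -> 'I_n -> set R) : set 'M[R]_n :=
  [set x | forall i j, I i j (x i j)].

Definition freq (n p : nat) (E : set 'M[R]_n) : R :=
  #|[set A in SL n p | `[< E (s_map R A) >]]%SET|%:R / #|SL n p|%:R.

(** The square root of the relative error in [card_det1_split]; it is of order [p] to the power
    -1/2. *)
Definition freq_err (m p : nat) : R := Num.sqrt ((m + 6)%:R / p%:R).

(** The normalisation is the expected order of SL: all matrices, divided by [p]. A box is a
    condition [P] on the first row and a condition [W] on the others, as [card_det1_split]
    requires. *)
Lemma card_SL_box (m p : nat) (I : 'I_m.+1 -> 'I_m.+1 -> set R) :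
  (0 < m)%N -> prime p ->
  `| #|[set A in SL m.+1 p | `[< box I (s_map R A) >]]%SET|%:R /
      (p%:R ^+ (m.+1 * m.+1) / p%:R)
     - \prod_(i < m.+1) \prod_(j < m.+1) ((count_frac p (I i j))%:R / p%:R) |
  <= freq_err m p.
Proof.
move=> m0 pp; have P0 : 0 < p%:R :> R by rewrite ltr0n prime_gt0.
pose S i j := [set t : 'F_p | `[< I i j ((t : nat)%:R / p%:R) >]]%SET.
pose P := [set x : 'M['F_p]_(1, 1 + m) |
  [forall i, forall j, x i j \in S (lshift m i) j]]%SET.
pose W := [set x : 'M['F_p]_(m, 1 + m) |
  [forall i, forall j, x i j \in S (rshift 1 i) j]]%SET.
have cS i j : #|S i j| = count_frac p (I i j) by rewrite card_Fp_frac.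
have := @card_det1_split 'F_p R m P W m0.
rewrite (_ : finset _ =
  [set A in SL m.+1 p | `[< box I (s_map R A) >]]%SET); last first.
  apply/setP => A; rewrite !inE; congr (_ && _).
  apply/andP/asboolP => [[/forallP AP /forallP AW] i j|IA].
    rewrite mxE; case: (splitP (i : 'I_(1 + m))) => k ik.
      have /forallP/(_ j) := AP k; rewrite !inE mxE.
      by rewrite (_ : lshift m k = i) //; apply: ord_inj; exact: esym ik.
    have /forallP/(_ j) := AW k; rewrite !inE mxE.
    by rewrite (_ : rshift 1 k = i) //; apply: ord_inj; exact: esym ik.
  split; apply/forallP => i; apply/forallP => j; rewrite !inE !mxE.
    by have := IA (lshift m i) j; rewrite mxE.
  by have := IA (rshift 1 i) j; rewrite mxE.
rewrite (card_Fp pp); set c := #|_|; set T := p%:R ^+ _.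
have T0 : 0 < T by rewrite exprn_gt0.
have PW : (#|P| * #|W| = \prod_(i < m.+1) \prod_(j < m.+1) count_frac p (I i j))%N.
  rewrite !card_box_mx [RHS](@big_split_ord _ _ _ 1 m).
  by congr (_ * _)%N; apply: eq_bigr => i _; apply: eq_bigr => j _; rewrite cS.
have -> : \prod_(i < m.+1) \prod_(j < m.+1) ((count_frac p (I i j))%:R / p%:R) =
    #|P|%:R * #|W|%:R / T.
  rewrite -natrM PW natr_prod /T exprM -[X in _ / _ ^+ X]card_ord -prodr_const.
  rewrite -prodf_div; apply: eq_bigr => i _.
  by rewrite natr_prod -[X in _ / _ ^+ X]card_ord -prodr_const -prodf_div.
move=> H; rewrite -ler_sqr ?nnegrE ?sqrtr_ge0 // real_normK ?num_real //.
rewrite sqr_sqrtr ?divr_ge0 ?ler0n //.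
rewrite -(ler_pM2r (x := (T / p%:R) ^+ 2)) ?exprn_gt0 ?divr_gt0 // -exprMn.
rewrite mulrBl divfK ?gt_eqF ?divr_gt0 // mulrA divfK ?gt_eqF //.
by rewrite [leRHS]mulrAC.
Qed.

(** The full box in [card_SL_box] estimates the order of SL itself, and the quotient of the two
    estimates is the frequency. *)
Lemma freq_box (m p : nat) (I : 'I_m.+1 -> 'I_m.+1 -> set R) :
  (0 < m)%N -> prime p -> 2 * freq_err m p <= 1 ->
  `| freq p (box I)
     - \prod_(i < m.+1) \prod_(j < m.+1) ((count_frac p (I i j))%:R / p%:R) |
  <= 4 * freq_err m p.
Proof.
move=> m0 pp e1; have P0 : 0 < p%:R :> R by rewrite ltr0n prime_gt0.
have := card_SL_box I m0 pp; have := card_SL_box (fun _ _ => setT) m0 pp.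
rewrite [X in `|_ - X|]big1 => [|i _]; last first.
  rewrite big1 // => j _; rewrite /count_frac (eq_bigr (fun=> 1)%N) => [|k _].
    by rewrite sum_nat_const_nat subn0 muln1 divff ?gt_eqF.
  by case: asboolP => // /(_ Logic.I).
rewrite (_ : finset _ = SL m.+1 p); last first.
  by apply/setP => A; rewrite inE andbC; case: asboolP => // [[]].
set T := _ / p%:R; have T0 : 0 < T by rewrite divr_gt0 ?exprn_gt0.
rewrite /freq; set s := #|SL _ _|%:R; set c := #|_|%:R; set b := \prod_(i < _) _.
set e := freq_err m p in e1 *.
have b0 : 0 <= b.
  by apply: prodr_ge0 => i _; apply: prodr_ge0 => j _; rewrite divr_ge0.
have b1 : b <= 1.
  apply: prodr_ile1 => i _; rewrite prodr_ge0 => [/=|j _]; last by rewrite divr_ge0.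
  apply: prodr_ile1 => j _; rewrite divr_ge0 //= ler_pdivrMr // mul1r ler_nat.
  exact: count_frac_le.
rewrite !ler_norml => /andP[s1 s2] /andP[c1 c2].
(* The difference of [c / s] and [b], multiplied by [s / T], is at most [e + b * e <= 2 * e] in
   absolute value; dividing by at least 1/2 gives the factor 4. *)
have sT : 2^-1 <= s / T by lra.
have s0 : 0 < s by rewrite -(pmulr_lgt0 _ (x := T^-1)) ?invr_gt0 //; lra.
have E : c / s * (s / T) = c / T by field; rewrite !gt_eqF.
have e0 : 0 <= e by apply: sqrtr_ge0.
move: (c / s) (s / T) (c / T) E sT s1 s2 c1 c2 => u v w <- v2 v1 v3 w1 w2.
apply/andP; split; nra.
Qed.
End FrequencyOfSL.

(** * Frequencies in boxes for large primes *)

Section BoxFrequencyLimits.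
Variable R : realType.

(** Splits an error among [k] boxes; the denominator [k.+1] keeps the share positive even for
    [k = 0]. *)
Lemma sum_divS_le (k : nat) (e : R) : 0 < e -> \sum_(c < k) (e / k.+1%:R) <= e.
Proof.
move=> e0; rewrite sumr_const card_ord -[leLHS]mulr_natr mulrAC.
by rewrite ler_pdivrMr // ler_pM2l // ler_nat.
Qed.

(** Continuity of the volume in the side lengths, the entries of [D]. *)
Lemma prod_entries_near (n : nat) (D : 'M[R]_n) (e : R) : 0 < e ->
  exists2 d : R, 0 < d & forall D' : 'M[R]_n,
    (forall i j, `|D i j - D' i j| < d) ->
    `| \prod_(i < n) \prod_(j < n) D' i j - \prod_(i < n) \prod_(j < n) D i j | <= e.
Proof.
move=> e0.
have C : continuous (fun M : 'M[R]_n => \prod_(i < n) \prod_(j < n) M i j).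
  apply: (@continuous_big R^o _ *%R 1 xpredT) => [|i _]; first exact: mul_continuous.
  apply: (@continuous_big R^o _ *%R 1 xpredT) => [|j _]; first exact: mul_continuous.
  exact: coord_continuous.
have /cvgr_dist_le/(_ e e0) := C D.
move=> /nbhs_ballP[d /= d0 dP]; exists d => // D' DD'.
by rewrite distrC; apply: dP; split.
Qed.

Lemma invr_nat_near (e : R) : 0 < e ->
  \forall p \near \oo, p%:R^-1 <= e.
Proof.
move=> e0; near=> p.
have p0 : 0 < p%:R :> R by rewrite ltr0n; near: p; exact: nbhs_infty_gt.
rewrite -[e]invrK lef_pV2 ?posrE ?invr_gt0 //.
by near: p; exact: nbhs_infty_ger.
Unshelve. all: by end_near. Qed.

Lemma freq_err_near (m : nat) (e : R) : 0 < e ->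
  \forall p \near \oo, freq_err R m p <= e.
Proof.
move=> e0; have m6 : 0 < (m + 6)%:R :> R by rewrite ltr0n addnS.
have := @invr_nat_near (e ^+ 2 / (m + 6)%:R).
rewrite divr_gt0 ?exprn_gt0 // => /(_ isT).
apply: filterS => p pe; rewrite -(ger0_norm (ltW e0)) -sqrtr_sqr ler_wsqrtr //.
by rewrite mulrC -ler_pdivlMr.
Qed.

Lemma freq_le (n p : nat) (E E' : set 'M[R]_n) : E `<=` E' ->
  freq p E <= freq p E'.
Proof.
move=> EE'; rewrite ler_wpM2r ?invr_ge0 // ler_nat subset_leq_card //.
apply/fintype.subsetP => A; rewrite !inE => /andP[-> /asboolP EA].
by apply/asboolP; exact: EE'.
Qed.

Lemma box_volumeE (n : nat) (a b : 'M[R]_n) :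
  box_volume a b = \prod_(i < n) \prod_(j < n) (b - a) i j.
Proof. by apply: eq_bigr => i _; apply: eq_bigr => j _; rewrite !mxE. Qed.

(** Each side is overcounted by at most 1/p, so a slightly larger box bounds the product of the
    counts. The box may leave the unit cube, as the covers in [area] do. *)
Lemma freq_closed_box_le (m : nat) (a b : 'M[R]_m.+1) (e : R) : (0 < m)%N ->
  (forall i j, a i j <= b i j) -> 0 < e ->
  \forall p \near \oo, prime p -> freq p (closed_box a b) <= box_volume a b + e.
Proof.
move=> m0 ab e0; have e2 : 0 < e / 2 by rewrite divr_gt0.
have [d d0 dP] := prod_entries_near (b - a) e2.
have d2 : 0 < d / 2 by rewrite divr_gt0.
near=> p => pp.
have pd : p%:R^-1 <= d / 2 by near: p; exact: invr_nat_near.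
have e1 : 2 * freq_err R m p <= 1.
  rewrite -ler_pdivlMl // mulr1; near: p; apply: freq_err_near; by rewrite invr_gt0.
(* Four times [e / 8] is half of [e]; the other half pays for the longer sides. *)
have e3 : freq_err R m p <= e / 8 by near: p; apply: freq_err_near; rewrite divr_gt0.
have := freq_box (fun i j => [set x | a i j <= x <= b i j]) m0 pp e1.
rewrite -/(closed_box a b) ler_norml => /andP[_ F].
have G : \prod_(i < m.+1) \prod_(j < m.+1)
    ((count_frac p [set x | a i j <= x <= b i j])%:R / p%:R) <=
    \prod_(i < m.+1) \prod_(j < m.+1) ((b - a + const_mx p%:R^-1) i j).
  apply: ler_prod => i _; rewrite prodr_ge0 => [/=|*]; last by rewrite divr_ge0.
  apply: ler_prod => j _; rewrite divr_ge0 //= !mxE.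
  exact: count_frac_closed_le (prime_gt0 pp) (ab i j).
have /dP : forall i j, `|(b - a) i j - (b - a + const_mx p%:R^-1) i j| < d.
  move=> i j; rewrite !mxE opprD addNKr normrN ger0_norm ?invr_ge0 //.
  by rewrite (le_lt_trans pd) // ltr_pdivrMr // ltr_pMr // ltr1n.
rewrite -box_volumeE ler_norml => /andP[_ H].
move: F; set P := \prod_(i < _) \prod_(j < _) (_ / _) in G *; lra.
Unshelve. all: by end_near. Qed.

Definition open_box (n : nat) (a b : 'M[R]_n) : set 'M[R]_n :=
  [set x | forall i j, a i j < x i j < b i j].

Lemma freq_open_box_ge (m : nat) (a b : 'M[R]_m.+1) (e : R) : (0 < m)%N ->
  (forall i j, a i j <= b i j) -> (forall i j, 0 <= a i j) ->
  (forall i j, b i j <= 1) -> 0 < e ->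
  \forall p \near \oo, prime p -> box_volume a b - e <= freq p (open_box a b).
Proof.
move=> m0 ab a0 b1 e0; have e2 : 0 < e / 2 by rewrite divr_gt0.
have [d d0 dP] := prod_entries_near (b - a) e2.
have d2 : 0 < d / 2 by rewrite divr_gt0.
near=> p => pp.
have pd : p%:R^-1 <= d / 2 by near: p; exact: invr_nat_near.
have e1 : 2 * freq_err R m p <= 1.
  rewrite -ler_pdivlMl // mulr1; near: p; apply: freq_err_near; by rewrite invr_gt0.
have e3 : freq_err R m p <= e / 8 by near: p; apply: freq_err_near; rewrite divr_gt0.
have := freq_box (fun i j => [set x | a i j < x < b i j]) m0 pp e1.
rewrite -/(open_box a b) ler_norml => /andP[F _].
(* The side lengths as counted at [p], within 1/p of the true ones: the open interval bounds them
   below, the closed one above. *)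
pose D' : 'M[R]_m.+1 := \matrix_(i, j)
  ((count_frac p [set x | a i j < x < b i j])%:R / p%:R).
have /dP : forall i j, `|(b - a) i j - D' i j| < d.
  move=> i j; rewrite !mxE; apply: (@le_lt_trans _ _ (d / 2)); last first.
    by rewrite ltr_pdivrMr // ltr_pMr // ltr1n.
  apply: le_trans pd; rewrite distrC ler_distlC.
  have := count_frac_open_ge (prime_gt0 pp) (a0 i j) (b1 i j).
  have := count_frac_closed_le (prime_gt0 pp) (ab i j).
  have : (count_frac p [set x | a i j < x < b i j])%:R / p%:R <=
    (count_frac p [set x | a i j <= x <= b i j])%:R / p%:R :> R.
    rewrite ler_wpM2r ?invr_ge0 // ler_nat; apply: count_frac_mono.
    by move=> x /andP[/ltW ax /ltW xb]; apply/andP.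
  lra.
rewrite -box_volumeE.
have -> : \prod_(i < m.+1) \prod_(j < m.+1) D' i j =
  \prod_(i < m.+1) \prod_(j < m.+1)
    ((count_frac p [set x | a i j < x < b i j])%:R / p%:R).
  by apply: eq_bigr => i _; apply: eq_bigr => j _; rewrite !mxE.
rewrite ler_norml => /andP[H _].
move: F H; set P := \prod_(i < _) \prod_(j < _) (_ / _); lra.
Unshelve. all: by end_near. Qed.

Lemma freq_bigcup_le (n p k : nat) (E : 'I_k -> set 'M[R]_n) :
  freq p (\bigcup_a E a) <= \sum_(a < k) freq p (E a).
Proof.
rewrite -mulr_suml ler_wpM2r ?invr_ge0 // -natr_sum ler_nat.
rewrite -sum1dep_card.
under [leqRHS]eq_bigr do rewrite -sum1dep_card big_mkcond.
rewrite exchange_big /= [leqLHS]big_mkcond; apply: leq_sum => A _.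
case: asboolP => [[a _ Ea]|_]; last by rewrite andbF.
rewrite andbT; case: ifP => // _; rewrite (bigD1 a) //=.
by case: asboolP => // /(_ Ea).
Qed.

Lemma freq_trivIset_ge (n p k : nat) (E : 'I_k -> set 'M[R]_n) :
  trivIset setT E -> \sum_(a < k) freq p (E a) <= freq p (\bigcup_a E a).
Proof.
move=> /trivIsetP tE; rewrite -mulr_suml ler_wpM2r ?invr_ge0 // -natr_sum ler_nat.
rewrite -sum1dep_card.
under [leqLHS]eq_bigr do rewrite -sum1dep_card big_mkcond.
rewrite exchange_big /= [leqRHS]big_mkcond; apply: leq_sum => A _.
case: (boolP (A \in _)) => /= [_|_]; last by rewrite big1.
case: asboolP => [[a _ Ea]|nE]; last first.
  by rewrite big1 // => a _; case: asboolP => // Ea; case: nE; exists a.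
rewrite (bigD1 a) //= big1 ?addn0 => [|b ba]; first by case: ifP.
case: asboolP => // Eb; have /eqP := tE b a Logic.I Logic.I ba.
by move=> /eqP/seteqP[/(_ (s_map R A))] [].
Qed.
End BoxFrequencyLimits.

(** * Boxes and outer measure *)

Section BoxTopology.
Variable R : realType.

(** Flattening matrices to row vectors makes the box a product of segments. *)
Lemma closed_box_compact (n : nat) (a b : 'M[R]_n) : compact (closed_box a b).
Proof.
have vec_cont : continuous (@vec_mx R n n).
  move=> v A /nbhs_ballP[e /= e0 eA]; apply/nbhs_ballP; exists e => //= u [_ vu].
  by apply: eA; split=> // i j; rewrite !mxE.
have -> : closed_box a b = @vec_mx R n n @`
    [set v : 'rV[R]_(n * n) | forall k, `[mxvec a 0 k, mxvec b 0 k]%classic (v 0 k)].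
  apply/seteqP; split=> [x xab|_ [v vab <-] i j].
    exists (mxvec x); last by rewrite mxvecK.
    move=> k; case/mxvec_indexP: k => i j.
    by rewrite /= in_itv /= !mxvecE xab.
  by have := vab (mxvec_index i j); rewrite /= in_itv /= !mxvecE mxE.
apply: continuous_compact; first exact: continuous_subspaceT.
apply: (@rV_compact R _ (fun k => `[mxvec a 0 k, mxvec b 0 k]%classic)) => k.
exact: segment_compact.
Qed.

Lemma open_box_open (n : nat) (a b : 'M[R]_n) : open (open_box a b).
Proof.
rewrite openE => x xab; exists (fun i j => `]a i j, b i j[%classic).
  move=> i j; apply: open_nbhs_nbhs; split; first exact: interval_open.
  by rewrite /= in_itv /= xab.
by move=> y yab i j; have := yab i j; rewrite /= in_itv.
Qed.

Lemma box_volume_ge0 (n : nat) (a b : 'M[R]_n) :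
  (forall i j, a i j <= b i j) -> 0 <= box_volume a b.
Proof.
by move=> ab; apply: prodr_ge0 => i _; apply: prodr_ge0 => j _; rewrite subr_ge0.
Qed.

Lemma freq_ge0 (n p : nat) (E : set 'M[R]_n) : 0 <= freq p E.
Proof. by rewrite divr_ge0. Qed.

(** Provides compact sets inside open boxes, so that finite subcovers exist, with little loss of
    frequency. *)
Lemma box_shrink (m : nat) (a b : 'M[R]_m.+1) (e : R) : (0 < m)%N ->
  (forall i j, a i j <= b i j) -> (forall i j, 0 <= a i j) ->
  (forall i j, b i j <= 1) -> 0 < e ->
  exists a' b' : 'M[R]_m.+1, closed_box a' b' `<=` open_box a b /\
    \forall p \near \oo, prime p -> box_volume a b - e <= freq p (closed_box a' b').
Proof.
move=> m0 ab a0 b1 e0.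
have [/existsP[i /existsP[j ji]]|nondeg] :=
    boolP [exists i, exists j, a i j == b i j].
  (* The volume is 0, so the empty box, with its bounds reversed, suffices. *)
  exists (const_mx 1), (const_mx 0); split=> [x /(_ i j)|].
    by rewrite !mxE => /andP[x1 x0]; have := le_trans x1 x0; rewrite ler10.
  near=> p => _; rewrite /box_volume (bigD1 i) //= (bigD1 j) //= (eqP ji).
  by rewrite subrr !mul0r sub0r (le_trans _ (freq_ge0 _ _)) // oppr_le0 ltW.
have lt_ab i j : a i j < b i j.
  rewrite lt_neqAle ab andbT; apply: contraNneq nondeg => abij.
  by apply/existsP; exists i; apply/existsP; exists j; rewrite abij.
have e2 : 0 < e / 2 by rewrite divr_gt0.
have [d d0 dP] := prod_entries_near (b - a) e2.
(* Both ends of each side move inwards by the fraction [t]. Sides have length at most 1, so each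
   loses at most [2 * t < d]; [t <= 1/4] keeps the ends in order. *)
pose t := Num.min d 1 / 4.
have t0 : 0 < t by rewrite divr_gt0 // lt_min d0 /=.
have td : 2 * t < d.
  by have : Num.min d 1 <= d; [rewrite ge_min lexx | rewrite /t; lra].
have t1 : t <= 4^-1.
  by have : Num.min d 1 <= 1; [rewrite ge_min lexx orbT | rewrite /t; lra].
exists (a + t *: (b - a)), (b - t *: (b - a)); split=> [x xab i j|].
  have := xab i j; have := lt_ab i j; rewrite !mxE => abij /andP[ax xb].
  have : 0 < t * (b i j - a i j) by rewrite mulr_gt0 ?subr_gt0.
  by lra.
have H i j : 0 < t * (b i j - a i j) <= 4^-1 * (b i j - a i j).
  by rewrite mulr_gt0 ?subr_gt0 //= ler_wpM2r // subr_ge0.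
have ab' i j : (a + t *: (b - a)) i j <= (b - t *: (b - a)) i j.
  by rewrite !mxE; have := H i j; have := lt_ab i j; lra.
have a0' i j : 0 <= (a + t *: (b - a)) i j.
  by rewrite !mxE; have := H i j; have := a0 i j; lra.
have b1' i j : (b - t *: (b - a)) i j <= 1.
  by rewrite !mxE; have := H i j; have := b1 i j; lra.
have := freq_open_box_ge m0 ab' a0' b1' e2.
apply: filterS => p /[apply].
have /(freq_le p) : open_box (a + t *: (b - a)) (b - t *: (b - a)) `<=`
    closed_box (a + t *: (b - a)) (b - t *: (b - a)).
  by move=> x xab i j; have /andP[/ltW -> /ltW ->] := xab i j.
have /dP : forall i j,
    `|(b - a) i j - ((b - t *: (b - a)) - (a + t *: (b - a))) i j| < d.
  move=> i j; rewrite !mxE.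
  have -> : b i j - a i j -
      (b i j - t * (b i j - a i j) - (a i j + t * (b i j - a i j))) =
      2 * t * (b i j - a i j) by ring.
  have t20 : 0 <= 2 * t by lra.
  rewrite ger0_norm; last by rewrite mulr_ge0 // subr_ge0.
  apply: le_lt_trans td; rewrite ler_piMr //.
  by have := a0 i j; have := b1 i j; lra.
rewrite -!box_volumeE ler_norml => /andP[+ _]; lra.
Unshelve. all: by end_near. Qed.

Lemma box_expand (n : nat) (a b : 'M[R]_n) (e : R) :
  (forall i j, a i j <= b i j) -> 0 < e ->
  exists a' b' : 'M[R]_n, [/\ forall i j, a' i j <= b' i j,
    closed_box a b `<=` open_box a' b' & box_volume a' b' <= box_volume a b + e].
Proof.
move=> ab e0; have [d d0 dP] := prod_entries_near (b - a) e0.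
exists (a - const_mx (d / 3)), (b + const_mx (d / 3)); split.
- by move=> i j; rewrite !mxE; have := ab i j; lra.
- by move=> x xab i j; have := xab i j; rewrite !mxE; lra.
have /dP : forall i j,
    `|(b - a) i j - (b + const_mx (d / 3) - (a - const_mx (d / 3))) i j| < d.
  by move=> i j; rewrite !mxE ltr_norml; lra.
by rewrite -!box_volumeE ler_norml => /andP[_]; lra.
Qed.
End BoxTopology.

(** * Finite families of boxes against the outer measure *)

Section AreaBounds.
Variable R : realType.

(* The frequencies [freq p] of a large prime are additive and nearly equal to the
   volume on each of the finitely many boxes that compactness leaves. *)
Lemma le_area (m k : nat) (a b : 'I_k -> 'M[R]_m.+1) (X : set 'M[R]_m.+1) :
  (0 < m)%N -> (forall c i j, a c i j <= b c i j) ->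
  (forall c i j, 0 <= a c i j) -> (forall c i j, b c i j <= 1) ->
  trivIset setT (fun c => open_box (a c) (b c)) ->
  (forall c, open_box (a c) (b c) `<=` X) ->
  ((\sum_(c < k) box_volume (a c) (b c))%:E <= area X)%E.
Proof.
move=> m0 ab a0 b1 tI sX; apply/ereal_infP => _ [al [be [albe Xcov ->]]].
(* The three thirds pay for shrinking the given boxes, for enlarging the covering boxes by the
   summable [eta], and for the frequencies in the finite subcover. *)
apply/lee_addgt0Pr => e e0; pose e1 := e / 3.
have e10 : 0 < e1 by rewrite divr_gt0.
have ek0 (K : nat) : 0 < e1 / K.+1%:R by rewrite divr_gt0.
have /choice[f fP] c : exists ab' : 'M[R]_m.+1 * 'M[R]_m.+1,
    closed_box ab'.1 ab'.2 `<=` open_box (a c) (b c) /\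
    \forall p \near \oo, prime p ->
      box_volume (a c) (b c) - e1 / k.+1%:R <= freq p (closed_box ab'.1 ab'.2).
  have [a' [b' ?]] := box_shrink m0 (ab c) (a0 c) (b1 c) (ek0 k).
  by exists (a', b').
pose eta i := e1 / (2 ^ i.+1)%:R.
have eta0 i : 0 < eta i by rewrite divr_gt0 // ltr0n expn_gt0.
have /choice[g gP] i : exists ab' : 'M[R]_m.+1 * 'M[R]_m.+1,
    [/\ forall r s, ab'.1 r s <= ab'.2 r s,
     closed_box (al i) (be i) `<=` open_box ab'.1 ab'.2 &
     box_volume ab'.1 ab'.2 <= box_volume (al i) (be i) + eta i].
  have [a' [b' ?]] := box_expand (albe i) (eta0 i).
  by exists (a', b').
pose O i := open_box (g i).1 (g i).2.
have /choice[N NP] c : exists N : nat, forall x,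
    closed_box (f c).1 (f c).2 x -> exists2 i, (i < N)%N & O i x.
  have := @closed_box_compact R _ (f c).1 (f c).2.
  rewrite compact_cover => /(_ nat setT O) [i _|x xK|D _ DK].
  - exact: open_box_open.
  - have [_ _] := gP 0%N.
    have /Xcov [i _ xi] := sX c _ ((fP c).1 _ xK).
    by exists i => //; have [_ + _] := gP i; apply.
  (* The successor makes the bound on the indices of the subcover strict. *)
  exists (\max_(i <- D) i.+1)%N => x /DK[i /= iD xi]; exists i => //.
  exact: leq_bigmax_seq (iD) _.
pose M := (\max_(c < k) N c)%N.
have nearf : \forall p \near \oo, forall c, prime p ->
    box_volume (a c) (b c) - e1 / k.+1%:R <= freq p (closed_box (f c).1 (f c).2).
  by apply: filter_forall => c; have [] := fP c.
have nearg : \forall p \near \oo, forall i : 'I_M, prime p ->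
    freq p (closed_box (g i).1 (g i).2) <=
      box_volume (g i).1 (g i).2 + e1 / M.+1%:R.
  by apply: filter_forall => i; have [gi _ _] := gP i; apply: freq_closed_box_le.
(* Finitely many estimates hold beyond a common threshold, and a single prime above it is enough to
   compare the two families. *)
have [n _ nP] := filterI nearf nearg.
have [p np pp] := prime_above n.
have [{}nearf {}nearg] := nP p (ltnW np).
have le1 : \sum_(c < k) box_volume (a c) (b c) <=
   \sum_(i < M) (box_volume (al i) (be i) + eta i) + 2 * e1.
  apply: (@le_trans _ _ (\sum_(c < k) freq p (closed_box (f c).1 (f c).2) + e1)).
    apply: (@le_trans _ _ (\sum_(c < k)
        (freq p (closed_box (f c).1 (f c).2) + e1 / k.+1%:R))).
      by apply: ler_sum => c _; rewrite -lerBlDr; apply: nearf.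
    by rewrite big_split lerD2l sum_divS_le.
  rewrite mulr_natl mulr2n addrA lerD2r.
  apply: le_trans (freq_trivIset_ge _ _) _.
    apply/trivIsetP => c c' _ _ cc'.
    apply: subsetI_eq0 (fP c).1 (fP c').1 _.
    by move/trivIsetP: tI; apply.
  apply: (@le_trans _ _ (freq p (\bigcup_(i in [set: 'I_M])
      closed_box (g i).1 (g i).2))).
    apply: freq_le => x [c _ /NP[i iN xi]].
    have iM : (i < M)%N by apply: leq_trans iN _; exact: leq_bigmax.
    exists (Ordinal iM) => // r s.
    by have /andP[/ltW -> /ltW ->] := xi r s.
  apply: le_trans (freq_bigcup_le _ _) _.
  apply: (@le_trans _ _ (\sum_(i < M)
      (box_volume (al i) (be i) + eta i + e1 / M.+1%:R))).
    apply: ler_sum => i _; apply: le_trans (nearg i pp) _; rewrite lerD2r.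
    by have [] := gP i.
  by rewrite big_split lerD2l sum_divS_le.
apply: (@le_trans _ _ ((\sum_(i < M) (box_volume (al i) (be i) + eta i))%:E
    + (2 * e1)%:E)%E).
  by rewrite -EFinD lee_fin.
have -> : e%:E = (e1%:E + (2 * e1)%:E)%E.
  by rewrite -EFinD; congr EFin; rewrite /e1; field.
rewrite addeA leeD2r //.
have vol0 i : (0 <= (box_volume (al i) (be i))%:E)%E.
  by rewrite lee_fin box_volume_ge0.
apply: le_trans (epsilon_trick xpredT vol0 (ltW e10)).
rewrite -sumEFin.
rewrite -(big_mkord xpredT (fun i => (box_volume (al i) (be i) + eta i)%:E)).
apply: nneseries_lim_ge => i _ _.
by rewrite lee_fin addr_ge0 ?box_volume_ge0 // ltW.
Qed.

(** Listing the [k] boxes in front of any cover of [Y] gives a cover of [X]. *)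
Lemma area_le (n k : nat) (a b : 'I_k -> 'M[R]_n) (X Y : set 'M[R]_n) :
  (forall c i j, a c i j <= b c i j) ->
  X `<=` \bigcup_c closed_box (a c) (b c) `|` Y ->
  (area X <= (\sum_(c < k) box_volume (a c) (b c))%:E + area Y)%E.
Proof.
move=> ab sX; rewrite -leeBlDl //; apply/ereal_infP => _ [al [be [albe Ycov ->]]].
rewrite leeBlDl //; apply: ereal_inf_lbound.
pose ext (u : 'I_k -> 'M[R]_n) (w : nat -> 'M[R]_n) i :=
  if insub i is Some c then u c else w (i - k)%N.
have ext_ord u w (c : 'I_k) : ext u w c = u c by rewrite /ext valK.
have ext_add u w i : ext u w (i + k)%N = w i.
  by rewrite /ext insubF ?addnK // ltnNge leq_addl.
have extab i r s : ext a al i r s <= ext b be i r s.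
  by rewrite /ext; case: insubP => [c _ _|_]; [exact: ab | exact: albe].
exists (ext a al), (ext b be); split=> // [x /sX[[c _ xc]|/Ycov[i _ xi]]|].
- by exists (c : nat) => //; rewrite !ext_ord.
- by exists (i + k)%N => //; rewrite !ext_add.
rewrite [RHS](nneseries_split 0 k) => [|i _]; last by rewrite lee_fin box_volume_ge0.
rewrite add0n big_mkord -sumEFin; congr (_ + _)%E.
  by apply: eq_bigr => c _; rewrite !ext_ord.
rewrite -[RHS]nneseries_addn => [|i]; last by rewrite lee_fin box_volume_ge0.
by apply: eq_eseriesr => i _; rewrite !ext_add.
Qed.

(** The endpoints are the infimum and the supremum; an empty interval gets both equal to 0. *)
Lemma interval_sandwich (I : interval R) : [set` I] `<=` `[0, 1] ->
  exists ab : R * R, [/\ 0 <= ab.1, ab.1 <= ab.2, ab.2 <= 1,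
    forall x, ab.1 < x < ab.2 -> x \in I & forall x, x \in I -> ab.1 <= x <= ab.2].
Proof.
move=> I01; have [[x0 x0I]|nI] := pselect (exists x, x \in I); last first.
  exists (0, 0); split=> //= x; last by move=> xI; case: nI; exists x.
  by move=> /andP[/lt_trans h /h]; rewrite ltxx.
have lb0 : lbound [set` I] 0 by move=> x /I01; rewrite /= in_itv => /andP[].
have ub1 : ubound [set` I] 1 by move=> x /I01; rewrite /= in_itv => /andP[].
have I0 : [set` I] !=set0 by exists x0.
have hI : has_inf [set` I] by split=> //; exists 0.
have hS : has_sup [set` I] by split=> //; exists 1.
have bnd x : x \in I -> inf [set` I] <= x <= sup [set` I].
  by move=> xI; rewrite (ge_inf hI.2) ?(sup_upper_bound hS).
exists (inf [set` I], sup [set` I]); split=> //=.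
- exact: lb_le_inf.
- by have /andP[] := bnd _ x0I; apply: le_trans.
- exact: ge_sup.
move=> x /andP[/(inf_lt I0)[y yI yx] /(sup_gt I0)[z zI xz]].
by apply: (interval_is_interval yI zI); rewrite (ltW yx) (ltW xz).
Qed.

Lemma rectangle_sandwich (n : nat) (B : set 'M[R]_n) : rectangle B ->
  exists ab : 'M[R]_n * 'M[R]_n,
    [/\ forall i j, 0 <= ab.1 i j, forall i j, ab.1 i j <= ab.2 i j,
        forall i j, ab.2 i j <= 1, open_box ab.1 ab.2 `<=` B &
        B `<=` closed_box ab.1 ab.2].
Proof.
move=> [I [I01 ->]].
have /choice[f fP] (ij : 'I_n * 'I_n) := interval_sandwich (I01 ij.1 ij.2).
exists (\matrix_(i, j) (f (i, j)).1, \matrix_(i, j) (f (i, j)).2); split=> /=.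
- by move=> i j; rewrite mxE; have [] := fP (i, j).
- by move=> i j; rewrite !mxE; have [] := fP (i, j).
- by move=> i j; rewrite mxE; have [] := fP (i, j).
- move=> x xab i j; have [_ _ _ + _] := fP (i, j); apply.
  by have := xab i j; rewrite !mxE.
- move=> x xI i j; have [_ _ _ _ +] := fP (i, j); rewrite !mxE; apply.
  exact: xI.
Qed.
End AreaBounds.

(** * From boxes to the set [X] *)

Lemma freq_image_s (R : realType) (n p : nat) (X : set 'M[R]_n) : prime p ->
  (#|` fset_set (image_s R n p `&` X)|)%:R / (#|SL n p|)%:R = freq p X.
Proof.
move=> pp; congr (_%:R / _).
pose S := [set A in SL n p | `[< X (s_map R A) >]]%SET.
have P0 : p%:R != 0 :> R by rewrite pnatr_eq0 -lt0n prime_gt0.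
(* Injectivity makes counting points of the image the same as counting matrices. *)
have s_inj : injective (@s_map R n p).
  move=> A B /matrixP AB; apply/matrixP => i j; have := AB i j; rewrite !mxE.
  by move/(mulIf (invr_neq0 P0))/eqP; rewrite eqr_nat => /eqP/val_inj.
have -> : image_s R n p `&` X = [set` [fset s_map R A | A in S]%fset].
  apply/seteqP; split=> [_ [[A AS <-] XA]|_ /= /imfsetP[A /= + ->]].
    by apply/imfsetP; exists A => //=; rewrite inE AS; apply/asboolP.
  by rewrite inE => /andP[AS /asboolP XA]; split=> //; exists A.
by rewrite set_fsetK card_imfset //= cardE.
Qed.

(* For n = 1 the group SL is trivial and the conclusion fails (take the set
   [0, 1/2]), hence n is at least 2. *)
Theorem theorem1p4 (R : realType) (n : nat) (hn : (1 < n)%N)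
  (X : set 'M[R]_n)
  (Xcube : X `<=` unit_cube R n)
  (mX : lebesgue_measurable X)
  (hX : forall e : R, 0 < e ->
    exists (k l : nat) (B : 'I_k -> set 'M[R]_n) (C : 'I_l -> set 'M[R]_n),
      [/\ (forall a, rectangle (B a)) /\ non_overlapping B,
          (forall c, rectangle (C c)) /\ non_overlapping C,
          \bigcup_a B a `<=` X /\ X `<=` \bigcup_c C c,
          (area (X `\` \bigcup_a B a) < e%:E)%E &
          (area ((\bigcup_c C c) `\` X) < e%:E)%E]) :
  ((#|` fset_set (image_s R n p `&` X)|)%:R / (#|SL n p|)%:R : R)%:E
    @[p --> within [set p | prime p] \oo] --> area X.
Proof.
case: n hn X Xcube mX hX => // m; rewrite ltnS => m0 X _ mX hX.
(* An open box inside [B c] lies in its interior, and non-overlapping rectangles have disjoint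
   interiors. *)
have open_disjoint k (B : 'I_k -> set 'M[R]_m.+1)
    (ab : 'I_k -> 'M[R]_m.+1 * 'M[R]_m.+1) :
    non_overlapping B -> (forall c, open_box (ab c).1 (ab c).2 `<=` B c) ->
    trivIset setT (fun c => open_box (ab c).1 (ab c).2).
  move=> /trivIsetP nB sB; apply/trivIsetP => c c' _ _ cc'.
  have sI d : open_box (ab d).1 (ab d).2 `<=` (B d)° .
    by rewrite -open_subsetE //; exact: open_box_open.
  by apply: subsetI_eq0 (sI c) (sI c') _; apply: nB.
(* Here [s] is the total volume of the inner rectangles, and frequencies add up over their disjoint
   open boxes. *)
have inner (e : R) : 0 < e -> exists s : R,
    (area X <= (s + e)%:E)%E /\ \forall p \near \oo, prime p -> s - e <= freq p X.
  move=> e0; have [k [_ [B [_ [[rB nB] _ [BX _] aB _]]]]] := hX e e0.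
  have /choice[f fP] c := rectangle_sandwich (rB c).
  exists (\sum_(c < k) box_volume (f c).1 (f c).2); split.
    rewrite EFinD; apply: le_trans (leeD2l _ (ltW aB)).
    apply: area_le => [c|x Xx]; first by have [] := fP c.
    have [[c _ Bx]|nB'] := pselect ((\bigcup_a B a) x); last by right.
    by left; exists c => //; have [_ _ _ _] := fP c; apply.
  have ek : 0 < e / k.+1%:R by rewrite divr_gt0.
  have : \forall p \near \oo, forall c, prime p ->
      box_volume (f c).1 (f c).2 - e / k.+1%:R <=
        freq p (open_box (f c).1 (f c).2).
    apply: filter_forall => c; have [a0 ab b1 _ _] := fP c.
    exact: freq_open_box_ge.
  apply: filterS => p H pp.
  apply: (@le_trans _ _ (\sum_(c < k) freq p (open_box (f c).1 (f c).2))).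
    rewrite lerBlDr.
    apply: (@le_trans _ _ (\sum_(c < k)
        (freq p (open_box (f c).1 (f c).2) + e / k.+1%:R))).
      by apply: ler_sum => c _; rewrite -lerBlDr; apply: H.
    by rewrite big_split lerD2l sum_divS_le.
  apply: le_trans (freq_trivIset_ge _ _) _.
    by apply: (open_disjoint _ B) => // c; have [] := fP c.
  apply: freq_le => x [c _ xc]; apply: BX; exists c => //.
  by have [_ _ _ + _] := fP c; apply.
(* Here [s] is the total volume of the outer rectangles, and [le_area] bounds it by the outer
   measure of their union. *)
have outer (e : R) : 0 < e -> exists s : R,
    (s%:E <= area X + e%:E)%E /\ \forall p \near \oo, prime p -> freq p X <= s + e.
  move=> e0; have [_ [k [_ [C [_ [rC nC] [_ XC] _ aC]]]]] := hX e e0.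
  have /choice[f fP] c := rectangle_sandwich (rC c).
  exists (\sum_(c < k) box_volume (f c).1 (f c).2); split.
    apply: (@le_trans _ _ (area (\bigcup_c C c))).
      apply: le_area => // [c|c|c||c]; try by have [] := fP c.
        by apply: (open_disjoint _ C) => // c; have [] := fP c.
      by move=> x xc; exists c => //; have [_ _ _ + _] := fP c; apply.
    (* Measurability of [X] splits the outer measure of the union into the part inside [X], which is
       [X] itself, and the small part outside. *)
    rewrite (mX (\bigcup_c C c)); apply: leeD; last by rewrite -setDE ltW.
    by rewrite setIidr.
  have ek : 0 < e / k.+1%:R by rewrite divr_gt0.
  have : \forall p \near \oo, forall c, prime p ->
      freq p (closed_box (f c).1 (f c).2) <=
        box_volume (f c).1 (f c).2 + e / k.+1%:R.
    apply: filter_forall => c; have [_ ab _ _ _] := fP c.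
    exact: freq_closed_box_le.
  apply: filterS => p H pp.
  apply: (@le_trans _ _ (freq p (\bigcup_(c in [set: 'I_k])
      closed_box (f c).1 (f c).2))).
    apply: freq_le => x /XC[c _ xc]; exists c => //.
    by have [_ _ _ _] := fP c; apply.
  apply: le_trans (freq_bigcup_le _ _) _.
  apply: (@le_trans _ _ (\sum_(c < k) (box_volume (f c).1 (f c).2 + e / k.+1%:R))).
    by apply: ler_sum => c _; apply: H.
  by rewrite big_split lerD2l sum_divS_le.
have area_fin : area X \is a fin_num.
  rewrite ge0_fin_numE.
    by have [s [/le_lt_trans + _]] := inner 1 ltr01; apply; rewrite ltry.
  apply/ereal_infP => _ [a [b [ab _ ->]]]; apply: nneseries_ge0 => i _ _.
  by rewrite lee_fin box_volume_ge0.
have [x xE] : exists x, area X = x%:E.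
  by exists (fine (area X)); rewrite fineK.
move: inner outer; rewrite xE => inner outer.
apply: (@cvg_EFin R nat); first by apply: nearW.
apply/cvgrPdist_le => e e0; have e2 : 0 < e / 2 by rewrite divr_gt0.
have [s [xs Hs]] := inner _ e2; have [t [tx Ht]] := outer _ e2.
rewrite lee_fin in xs; rewrite -EFinD lee_fin in tx.
apply: filterS (filterI Hs Ht) => p [sp tp] pp.
rewrite /= freq_image_s //; have := sp pp; have := tp pp.
by rewrite ler_norml => *; apply/andP; split; lra.
Qed.
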